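(* Let $G=(V,E)$ be a hypergraph and let $OPT_k$ be the value of a minimum $k$-cut in $G$ for some integer $k\ge2$. Suppose $(U,\overline U)$ is a 2-partition of $V$ with $d(U)\le OPT_k$. Then there exists a subset $S\subseteq U$ with $|S|\le 2k-2$ such that $(U,\overline U)$ is the source maximal minimum $(S,\overline U)$-terminal cut in $G$.
   Context: A hypergraph $G=(V,E)$ has finite vertex set $V$ and finite multiset $E$ of unit-cost hyperedges (subsets of $V$). For $X\subseteq V$, $\overline X=V\setminus X$ and $d(X)$ is the number of hyperedges meeting both $X$ and $\overline X$. $OPT_k$ is the minimum, over all partitions of $V$ into $k$ non-empty parts, of the number of hyperedges meeting at least two parts. For disjoint $S,T\subseteq V$, a 2-partition $(X,\overline X)$ is an $(S,T)$-terminal cut if $S\subseteq X\subseteq V\setminus T$; it is minimum if $d(X)$ is minimum among such cuts; the source maximal minimum $(S,T)$-terminal cut is the unique minimum one whose source set $X$ is inclusion-wise maximal. *)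

(* Defs.v *)
From mathcomp Require Import all_boot.
Set Implicit Arguments. Unset Strict Implicit. Unset Printing Implicit Defensive.

(* A hypergraph on the finite vertex type V is given by a multiset (seq) E of
   unit-cost hyperedges, each a subset of V. *)

Definition crosses (V : finType) (X : {set V}) (e : {set V}) : bool :=
  (e :&: X != set0) && (e :&: ~: X != set0).

Definition dcut (V : finType) (E : seq {set V}) (X : {set V}) : nat :=
  count (crosses X) E.

Definition is_kpartition (V : finType) (k : nat) (P : {set {set V}}) : bool :=
  partition P [set: V] && (set0 \notin P) && (#|P| == k).

Definition kcut_cost (V : finType) (E : seq {set V}) (P : {set {set V}}) : nat :=
  count (fun e => 2 <= #|[set B in P | e :&: B != set0]|) E.

(* OPT_k: minimum cost over all partitions of V into k non-empty parts.
   (The default value size E is only reached when no such partition exists,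
   i.e. when k > #|V|; the theorem assumes k <= #|V|.) *)
Definition OPT (V : finType) (E : seq {set V}) (k : nat) : nat :=
  \big[minn/size E]_(P : {set {set V}} | is_kpartition k P) kcut_cost E P.

Definition terminal_cut (V : finType) (S T X : {set V}) : bool :=
  [&& X != set0, ~: X != set0, S \subset X & X \subset ~: T].

Definition min_terminal_cut (V : finType) (E : seq {set V}) (S T X : {set V}) : bool :=
  terminal_cut S T X &&
  [forall Y : {set V}, terminal_cut S T Y ==> (dcut E X <= dcut E Y)].

(* source maximal minimum (S,T)-terminal cut: a minimum terminal cut whose
   source side contains the source side of every minimum terminal cut
   (i.e. it is the unique inclusion-wise maximal one). *)
Definition source_max_min_terminal_cut (V : finType) (E : seq {set V})
    (S T X : {set V}) : bool :=
  min_terminal_cut E S T X &&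
  [forall Y : {set V}, min_terminal_cut E S T Y ==> (Y \subset X)].

(* Main.v *)
Require Import Defs.
From mathcomp Require Import all_boot.
From mathcomp Require Import zify.

Set Implicit Arguments.
Unset Strict Implicit.
Unset Printing Implicit Defensive.

(** Every terminal cut for [(S, ~: U)] has its source side inside [U], so the
    claim is that [U] is a minimum [(S, ~: U)]-terminal cut for some small [S].
    Take an inclusion-minimal such [S] and suppose [#|S| >= 2k - 1].  For each
    [u] in [S], minimality yields a set [A u] containing [u] and [~: U], missing
    [S :\ u], with [d (A u) < d U].  Let [W] be the vertices in at least two of
    the [A u], [Z] those in none, and [Y_u] those in [A u] only.  Weigh a
    hyperedge by 2 if it meets both [W] and [Z] or two different [Y_u]'s, by 1
    if it meets two cells otherwise, and by 0 if it lies in one cell.  For two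
    sets the total weight is [d (A u1) + d (A u2)]; adding a further set [A u]
    changes it by at most [d (A u) - d (A u :&: W)], which is negative since
    [A u :&: W] separates [~: U] from [S].  So the total weight stays below
    [2 d U].  For disjoint [I, I'] in [S] of size [k - 1], the two k-partitions
    isolating the [Y_u] with [u] in [I], respectively [I'], have costs summing
    to at most the total weight, so one of them costs less than
    [d U <= OPT_k], a contradiction. *)

(** * Cells, split and heavy hyperedges *)

Section Cells.
Variable V : finType.
Implicit Types (c : V -> option (option V)) (X e : {set V}) (E : seq {set V}).

Lemma crossesP X e :
  reflect (exists x y, [/\ x \in e, y \in e, x \in X & y \notin X])
          (crosses X e).
Proof.
apply: (iffP andP) => [[/set0Pn[x] /setIP[xe xX] /set0Pn[y] /setIP[ye]]|].
  by rewrite inE => yX; exists x, y.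
case=> x [y [xe ye xX yX]].
by split; apply/set0Pn; [exists x | exists y]; rewrite !inE ?xe ?ye.
Qed.

Lemma crossesC X e : crosses (~: X) e = crosses X e.
Proof. by rewrite /crosses setCK andbC. Qed.

Lemma dcutC E X : dcut E (~: X) = dcut E X.
Proof. by apply: eq_count => e; rewrite crossesC. Qed.

Lemma crosses_neq X e x y :
  x \in e -> y \in e -> (x \in X) != (y \in X) -> crosses X e.
Proof.
move=> xe ye; case xX: (x \in X); case yX: (y \in X) => // _; apply/crossesP.
  by exists x, y; rewrite xX yX.
by exists y, x; rewrite xX yX.
Qed.

(* A cell function sends a vertex to [None] for Z, [Some None] for W and
   [Some (Some u)] for Y_u. *)
Definition Wcell c : {set V} := [set v | c v == Some None].

Definition heavy_pair (a b : option (option V)) : bool :=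
  match a, b with
  | None, Some None => true
  | Some (Some i), Some (Some j) => i != j
  | _, _ => false
  end.

Definition split_edge c e : bool := [exists x in e, exists y in e, c x != c y].

Definition heavy_edge c e : bool :=
  [exists x in e, exists y in e, heavy_pair (c x) (c y)].

Lemma split_edgeP c e :
  reflect (exists x y, [/\ x \in e, y \in e & c x != c y]) (split_edge c e).
Proof.
apply: (iffP existsP) => [[x /andP[xe /existsP[y /andP[ye xy]]]]|].
  by exists x, y.
case=> x [y [xe ye xy]]; exists x; rewrite xe /=.
by apply/existsP; exists y; rewrite ye.
Qed.

Lemma heavy_edgeP c e :
  reflect (exists x y, [/\ x \in e, y \in e & heavy_pair (c x) (c y)])
          (heavy_edge c e).
Proof.
apply: (iffP existsP) => [[x /andP[xe /existsP[y /andP[ye xy]]]]|].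
  by exists x, y.
case=> x [y [xe ye xy]]; exists x; rewrite xe /=.
by apply/existsP; exists y; rewrite ye.
Qed.

Lemma heavy_split c e : heavy_edge c e -> split_edge c e.
Proof.
case/heavy_edgeP=> x [y [xe ye xy]]; apply/split_edgeP; exists x, y; split=> //.
by move: xy; case: (c x) (c y) => [[?|]|] [[?|]|] //=; apply: contra => /eqP[->].
Qed.

(** A cell records whether a vertex lies in no set, in exactly one (and which), or in at least two;
    this is the update of that capped count. *)
Definition add_cell c (A : {set V}) (u : V) (v : V) : option (option V) :=
  if v \in A then (if c v is None then Some (Some u) else Some None) else c v.

(** * Change in the weight of one hyperedge when a set is added *)

Section AddCell.
Variables (c : V -> option (option V)) (A : {set V}) (u : V) (e : {set V}).
Let c' := add_cell c A u.
Let AW := A :&: Wcell c.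

Lemma split_add : split_edge c' e -> split_edge c e || crosses A e.
Proof.
case/split_edgeP=> x [y [xe ye]]; rewrite /c' /add_cell => xy.
have [Exy|nxy] := eqVneq (c x) (c y); last first.
  by apply/orP; left; apply/split_edgeP; exists x, y.
apply/orP; right; apply: (crosses_neq xe ye).
by move: xy; rewrite Exy; case: (x \in A); case: (y \in A); rewrite ?eqxx.
Qed.

(** Adding [A] breaks Z into Z and Y_u, each Y_w into Y_w and W, and leaves W whole; none of these
    pairs is heavy. *)
Lemma heavy_add_split : heavy_edge c' e -> split_edge c e.
Proof.
case/heavy_edgeP=> x [y [xe ye xy]]; apply/split_edgeP; exists x, y; split=> //.
move: xy; rewrite /c' /add_cell; apply: contraTN => /eqP->.
by case: (x \in A); case: (y \in A); case: (c y) => [[?|]|] //=; rewrite eqxx.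
Qed.

Lemma heavy_add : heavy_edge c' e -> heavy_edge c e || crosses A e.
Proof.
case/heavy_edgeP=> x [y [xe ye]]; rewrite /c' /add_cell => xy.
have [nA|] := boolP ((x \in A) != (y \in A)).
  by rewrite (crosses_neq xe ye nA) orbT.
rewrite negbK => /eqP Exy; apply/orP; left; apply/heavy_edgeP; exists x, y; split=> //.
move: xy; rewrite Exy; case: (y \in A) => //.
by case: (c x) (c y) => [[?|]|] [[?|]|] //=; rewrite eqxx.
Qed.

Lemma crosses_AW_split : crosses AW e -> crosses A e || split_edge c e.
Proof.
case/crossesP=> x [y [xe ye]]; rewrite !inE => /andP[xA /eqP xW].
rewrite negb_and => /orP[yA|yW].
  by rewrite (crosses_neq xe ye) // xA (negPf yA).
by apply/orP; right; apply/split_edgeP; exists x, y; rewrite xW eq_sym.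
Qed.

Lemma crosses_AW_split_add : crosses AW e -> split_edge c' e -> split_edge c e.
Proof.
case/crossesP=> w [t [we _]]; rewrite !inE => /andP[wA /eqP wW] _ {t}.
case/split_edgeP=> x [y [xe ye xy]]; apply/split_edgeP.
have [xW|] := eqVneq (c x) (c w); last by exists x, w.
have [yW|] := eqVneq (c y) (c w); last by exists y, w.
move: xy; rewrite /c' /add_cell xW yW wW.
by case: (x \in A); case: (y \in A); rewrite eqxx.
Qed.

(** If [e] does not cross [A], it lies inside [A], where new cells differ only between old Z and the
    rest; a vertex of [e] in Z is then heavy with one in W. *)
Lemma crosses_AW_split_heavy :
  crosses AW e -> split_edge c' e -> crosses A e || heavy_edge c e.
Proof.
case/crossesP=> w [t [we _]]; rewrite !inE => /andP[wA /eqP wW] _ {t}.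
case/split_edgeP=> x [y [xe ye]].
have [//|nA] := boolP (crosses A e).
have inA z : z \in e -> z \in A.
  by move=> ze; apply: contraNT nA => zA; apply/crossesP; exists w, z.
rewrite /c' /add_cell !inA //= => xy; apply/heavy_edgeP.
case Ex: (c x) xy => [cx|]; last by exists x, w; rewrite Ex wW.
case Ey: (c y) => [cy|]; last by exists y, w; rewrite Ey wW.
by rewrite eqxx.
Qed.

Lemma crosses_AW_heavy_crosses : crosses AW e -> heavy_edge c' e -> crosses A e.
Proof.
case/crossesP=> w [t [we _]]; rewrite !inE => /andP[wA /eqP wW] _ {t}.
case/heavy_edgeP=> x [y [xe ye]]; apply: contraLR => nA.
have inA z : z \in e -> z \in A.
  by move=> ze; apply: contraNT nA => zA; apply/crossesP; exists w, z.
rewrite /c' /add_cell !inA //=.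
by case: (c x) (c y) => [[?|]|] [[?|]|] //=; rewrite eqxx.
Qed.

(** An endpoint in Z is heavy with the vertex of [e] in W. Otherwise the endpoints can only move
    from some Y_w to W, which creates no heavy pair. *)
Lemma crosses_AW_heavy_add : crosses AW e -> heavy_edge c' e -> heavy_edge c e.
Proof.
case/crossesP=> w [t [we _]]; rewrite !inE => /andP[wA /eqP wW] _ {t}.
case/heavy_edgeP=> x [y [xe ye]] xy; apply/heavy_edgeP.
case Ex: (c x) => [cx|]; last by exists x, w; rewrite Ex wW.
case Ey: (c y) => [cy|]; last by exists y, w; rewrite Ey wW.
exists x, y; split=> //; move: xy.
rewrite /c' /add_cell Ex Ey.
by case: (x \in A); case: (y \in A); case: cx {Ex} => [?|]; case: cy {Ey}.
Qed.

(** The eight implications above, with heavy implying split, exclude every truth assignment that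
    violates the inequality. *)
Lemma weight_add :
  split_edge c' e + heavy_edge c' e + crosses AW e <= split_edge c e + heavy_edge c e + crosses A e.
Proof.
have := (@heavy_split c e, @heavy_split c' e).
have := (split_add, heavy_add_split, heavy_add, crosses_AW_split,
         crosses_AW_split_add, crosses_AW_split_heavy,
         crosses_AW_heavy_crosses, crosses_AW_heavy_add).
case: (split_edge c e); case: (heavy_edge c e); case: (split_edge c' e); case: (heavy_edge c' e);
  case: (crosses AW e); case: (crosses A e) => //=;
  move=> [[[[[[[h1 h2] h3] h4] h5] h6] h7] h8] [h9 h10];
  by [have := h1 isT | have := h2 isT | have := h3 isT | have := h4 isT
     | have := h5 isT isT | have := h6 isT isT | have := h7 isT isT
     | have := h8 isT isT | have := h9 isT | have := h10 isT].
Qed.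

End AddCell.

Definition weight E c : nat := count (split_edge c) E + count (heavy_edge c) E.

Lemma weight_add_cell E c A u :
  weight E (add_cell c A u) + dcut E (A :&: Wcell c) <= weight E c + dcut E A.
Proof.
rewrite /weight /dcut; elim: E => //= e E IH.
have := weight_add c A u e; lia.
Qed.

(** * Cells of a family of sets *)

Definition cells (A : V -> {set V}) (s : seq V) : V -> option (option V) :=
  foldr (fun u c => add_cell c (A u) u) (fun=> None) s.

Lemma weight_nil E (A : V -> {set V}) : weight E (cells A [::]) = 0.
Proof.
have hv : heavy_edge (cells A [::]) =1 pred0.
  by move=> e; apply/heavy_edgeP => -[x [y []]].
(* On the constant cell function the two predicates are convertible. *)
by rewrite /weight (eq_count hv) count_pred0.
Qed.

Lemma cells_notin (A : V -> {set V}) (s : seq V) v : (forall u, u \in s -> v \notin A u) -> cells A s v = None.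
Proof.
elim: s => //= u s IH sA; rewrite /add_cell (negPf (sA u _)) ?mem_head //.
by apply: IH => w ws; apply: sA; rewrite inE ws orbT.
Qed.

Lemma cells_all (A : V -> {set V}) (s : seq V) v :
  1 < size s -> (forall u, u \in s -> v \in A u) -> cells A s v = Some None.
Proof.
case: s => [//|u1 [//|u2 s]] _; elim: s u1 u2 => [|u3 s IH] u1 u2 sA.
  by rewrite /= /add_cell !sA // !inE eqxx ?orbT.
change (add_cell (cells A (u2 :: u3 :: s)) (A u1) u1 v = Some None).
rewrite /add_cell sA ?mem_head // IH // => w ws; apply: sA.
by rewrite inE ws orbT.
Qed.

Lemma cells_self (A : V -> {set V}) (s : seq V) u :
  uniq s -> u \in s -> u \in A u ->
  (forall w, w \in s -> w != u -> u \notin A w) -> cells A s u = Some (Some u).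
Proof.
elim: s => //= w s IH /andP[ws us]; rewrite inE /add_cell => /predU1P[uw|uins] uA sA.
  rewrite -uw in ws *; rewrite uA cells_notin // => x xs; apply: sA; first by rewrite inE xs orbT.
  by apply: contraNneq ws => <-.
have wu : w != u by apply: contraNneq ws => ->.
rewrite (negPf (sA w _ wu)) ?mem_head // IH // => x xs.
by apply: sA; rewrite inE xs orbT.
Qed.

(** * Partitions isolating chosen cells, and their costs *)

Definition isolate c (I : {set V}) (v : V) : option V :=
  if c v is Some (Some u) then (if u \in I then Some u else None) else None.

(** The label [None] gathers W, Z and all Y_u with [u] outside [I] into one remaining part. *)
Definition isolating_partition c (I : {set V}) : {set {set V}} :=
  [set isolate c I @^-1: [set l] | l in None |: Some @: I].

Lemma isolate_in c I v : isolate c I v \in None |: Some @: I.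
Proof.
rewrite !inE /isolate; case: (c v) => [[u|]|] //.
by case: ifP => // uI; rewrite imset_f ?orbT.
Qed.

(** No part is empty: [u] itself has label [Some u], and [z] has label [None]. *)
Lemma isolating_partitionP c (I : {set V}) z :
  (forall u, u \in I -> c u = Some (Some u)) -> isolate c I z = None ->
  is_kpartition #|I|.+1 (isolating_partition c I).
Proof.
move=> cI zI; set f := isolate c I.
have onto l : l \in None |: Some @: I -> exists v, f v = l.
  case/setU1P=> [->|/imsetP[u uI ->]]; first by exists z.
  by exists u; rewrite /f /isolate cI // uI.
have n0 : set0 \notin isolating_partition c I.
  apply/imsetP => -[l /onto[v fv] /setP/(_ v)].
  by rewrite !inE -/f fv eqxx.
rewrite /is_kpartition n0 andbT; apply/andP; split.
  rewrite /partition n0 andbT; apply/andP; split.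
    rewrite eqEsubset subsetT; apply/subsetP => v _; apply/bigcupP.
    exists (f @^-1: [set f v]); last by rewrite !inE.
    by apply: imset_f; apply: isolate_in.
  apply/trivIsetP => _ _ /imsetP[l _ ->] /imsetP[m _ ->] lm.
  rewrite -setI_eq0; apply/eqP/setP => v; rewrite !inE.
  by apply: contraNF lm => /andP[/eqP<- /eqP<-].
rewrite card_in_imset => [|l m /onto[v fv] _ /setP/(_ v)]; last first.
  by rewrite !inE -/f fv eqxx => /esym/eqP.
rewrite cardsU1 card_imset; last by move=> ? ? [].
by have -> : None \notin Some @: I by apply/imsetP => -[].
Qed.

Lemma isolate_some c (I : {set V}) v u :
  isolate c I v = Some u -> u \in I /\ c v = Some (Some u).
Proof. by rewrite /isolate; case: (c v) => [[w|]|] //; case: ifP => // ? [<-]. Qed.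

Lemma isolating_cut_edge c (I : {set V}) e :
  1 < #|[set B in isolating_partition c I | e :&: B != set0]| ->
  split_edge c e /\ exists x u, [/\ x \in e, u \in I & c x = Some (Some u)].
Proof.
case/card_gt1P=> B [C []]; rewrite !inE.
case/andP=> /imsetP[l _ ->] /set0Pn[x /setIP[xe]]; rewrite !inE => /eqP<-.
case/andP=> /imsetP[m _ ->] /set0Pn[y /setIP[ye]]; rewrite !inE => /eqP<- ne.
have fxy : isolate c I x != isolate c I y by apply: contraNneq ne => ->.
split.
  apply/split_edgeP; exists x, y; split=> //.
  by apply: contraNneq fxy => cxy; rewrite /isolate cxy.
case Ex: (isolate c I x) fxy => [u|].
  by case: (isolate_some Ex) => uI cx _; exists x, u.
case Ey: (isolate c I y) => [u|//] _.
by case: (isolate_some Ey) => uI cy; exists y, u.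
Qed.

(** A hyperedge cut by either partition is split. One cut by both meets Y_u and Y_w with [u] in [I]
    and [w] in [J], distinct by disjointness, so it is heavy. *)
Lemma isolating_costs E c (I J : {set V}) :
  [disjoint I & J] ->
  kcut_cost E (isolating_partition c I) + kcut_cost E (isolating_partition c J)
    <= weight E c.
Proof.
move=> dIJ; rewrite /kcut_cost /weight.
set a := fun e : {set V} => 1 < _; set b := fun e : {set V} => 1 < _.
have ab e : a e + b e <= split_edge c e + heavy_edge c e.
  case ae: (a e); case be: (b e) => //.
  - have [-> [x [u [xe uI cx]]]] := isolating_cut_edge ae.
    have [_ [y [w [ye wJ cy]]]] := isolating_cut_edge be.
    suff -> : heavy_edge c e by [].
    apply/heavy_edgeP; exists x, y; rewrite cx cy; split=> //=.
    by apply: contraTneq wJ => <-; rewrite (disjointFr dIJ).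
  - by have [-> _] := isolating_cut_edge ae.
  - by have [-> _] := isolating_cut_edge be.
elim: E => //= e E IH; have := ab e; lia.
Qed.

Lemma OPT_le E k P : is_kpartition k P -> OPT E k <= kcut_cost E P.
Proof.
move=> kP; rewrite /OPT; have := mem_index_enum P.
elim: (index_enum _) => //= Q r IH; rewrite big_cons inE => /predU1P[<-|/IH le].
  by rewrite kP geq_minl.
by case: ifP => // _; apply: leq_trans (geq_minr _ _) le.
Qed.

Lemma OPT_le_weight E A (s : seq V) z k :
  0 < k -> uniq s -> 2 * k - 2 <= size s ->
  (forall u, u \in s -> cells A s u = Some (Some u)) ->
  cells A s z = Some None -> 2 * OPT E k <= weight E (cells A s).
Proof.
(* Two consecutive blocks of [k - 1] entries; [z], being in W, keeps the remaining part non-empty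
   for both. *)
move=> k0 us ks sY zW; set I := take k.-1 s; set J := take k.-1 (drop k.-1 s).
have uD : uniq (drop k.-1 s) by rewrite drop_uniq.
have IsJ : [disjoint [set x in I] & [set x in J]].
  rewrite disjoints_subset; apply/subsetP => x; rewrite !inE => xI.
  apply/negP => /mem_take xJ; move: us; rewrite -(cat_take_drop k.-1 s) cat_uniq.
  by case/and3P=> _ /hasPn/(_ x xJ); rewrite /= xI.
have part (L : seq V) : {subset L <= s} -> uniq L -> size L = k.-1 ->
    OPT E k <= kcut_cost E (isolating_partition (cells A s) [set x in L]).
  move=> Ls uL sL; apply: OPT_le.
  have <- : #|[set x in L]|.+1 = k.
    by rewrite cardsE (card_uniqP uL) sL prednK.
  apply: (@isolating_partitionP _ _ z); last by rewrite /isolate zW.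
  by move=> u; rewrite inE => /Ls/sY.
have := isolating_costs E (cells A s) IsJ.
have := part I (@mem_take _ _ _) (take_uniq _ us).
have := part J (fun x xJ => mem_drop (mem_take xJ)) (take_uniq _ uD).
rewrite !size_takel ?size_drop; lia.
Qed.

End Cells.

Theorem theorem5p1 (V : finType) (E : seq {set V}) (k : nat) (U : {set V}) :
  2 <= k -> k <= #|V| ->
  U != set0 -> ~: U != set0 ->
  dcut E U <= OPT E k ->
  exists S : {set V},
    [/\ S \subset U, #|S| <= 2 * k - 2 &
        source_max_min_terminal_cut E S (~: U) U].
Proof.
move=> k2 _ U0 CU0 dU.
pose good (S : {set V}) := (S \subset U) && min_terminal_cut E S (~: U) U.
have termU (S : {set V}) : S \subset U -> terminal_cut S (~: U) U.
  by move=> SU; rewrite /terminal_cut U0 CU0 SU setCK /=.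
(* With [U] as source terminals, [U] is the only terminal cut. *)
have goodU : good U.
  rewrite /good subxx /min_terminal_cut termU //=; apply/forallP => X.
  apply/implyP => /and4P[_ _ UX]; rewrite setCK => XU.
  by have -> : X = U by apply/eqP; rewrite eqEsubset XU.
have [S /minsetP[/andP[SU minS] Smin] _] := minset_exists goodU.
exists S; split=> //; last first.
  rewrite /source_max_min_terminal_cut minS; apply/forallP => X.
  by apply/implyP => /andP[/and4P[_ _ _]]; rewrite setCK.
rewrite leqNgt; apply/negP => Sk.
have lowS (C : {set V}) : ~: U \subset C -> [disjoint S & C] -> dcut E U <= dcut E C.
  move=> UC SC; case/andP: minS => _ /forallP/(_ (~: C))/implyP; rewrite dcutC.
  apply; rewrite /terminal_cut setCK -disjoints_subset SC setCS UC !andbT.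
  apply/andP; split.
    have /card_gt0P[x xS] : 0 < #|S| by lia.
    by apply/set0Pn; exists x; rewrite inE (disjointFr SC).
  by apply: contraNneq CU0 => C0; rewrite -subset0 -C0.
(* The premise sits under the existential so that [A] can be chosen on all of [V]; [set0] is a dummy
   value outside [S]. *)
have exA u : exists B : {set V}, u \in S ->
    [/\ ~: U \subset B, u \in B, [disjoint S :\ u & B] & dcut E B < dcut E U].
  have [uS|] := boolP (u \in S); last by exists set0.
  have : ~~ good (S :\ u).
    apply: contraL uS => gS.
    by rewrite -(Smin _ gS) ?subsetDl // !inE eqxx.
  have SuU : S :\ u \subset U by apply: subset_trans (subsetDl _ _) SU.
  rewrite /good SuU /min_terminal_cut termU //= => /forallPn[X].
  rewrite negb_imply -ltnNge => /andP[/and4P[X0 CX0 SX XU] dX].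
  exists (~: X) => _; split; last 1 first.
  - by rewrite dcutC.
  - by rewrite -setCS !setCK -[U]setCK.
  (* If [u] were in [X], then [X] would be a terminal cut for [S] itself, hence no cheaper than
     [U]. *)
  - rewrite inE; apply: contraTN dX => uX; rewrite -leqNgt.
    case/andP: minS => _ /forallP/(_ X)/implyP; apply.
    rewrite /terminal_cut X0 CX0 XU andbT /=.
    by rewrite -(setD1K uS) subUset sub1set uX.
  - by rewrite disjoints_subset setCK.
have [A AP] := fin_all_exists exA.
set s := enum S.
have ss : size s = #|S| by rewrite -cardE.
have sS (t : seq V) : {subset t <= s} -> forall u, u \in t -> u \in S.
  by move=> ts u /ts; rewrite mem_enum.
have [z zU] := set0Pn _ CU0.
have Az u : u \in S -> z \in A u by case/AP => /subsetP/(_ z zU).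
have AS u w : u \in S -> w \in S -> w != u -> u \notin A w.
  move=> uS wS wu; have [_ _ /disjointFr->] := AP w wS => //.
  by rewrite !inE eq_sym wu.
(* Induction starts at two sets, since W contains [~: U] only from then on. *)
have light (t : seq V) : {subset t <= s} -> 1 < size t -> uniq t ->
    weight E (cells A t) < 2 * dcut E U.
  case: t => [//|u1 [//|u2 t]] + _; elim: t u1 u2 => [|u3 t IH] u1 u2 ts.
    move=> _; have [_ _ _ d1] := AP u1 (sS _ ts _ (mem_head _ _)).
    have u2s : u2 \in [:: u1; u2] by rewrite !inE eqxx orbT.
    have [_ _ _ d2] := AP u2 (sS _ ts _ u2s).
    have := weight_add_cell E (cells A [:: u2]) (A u1) u1.
    have := weight_add_cell E (cells A [::]) (A u2) u2.
    rewrite weight_nil -!/(cells A _) /=; lia.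
  move=> /= /andP[u1t ut]; set t' := u2 :: u3 :: t.
  have t's : {subset t' <= s} by move=> x xt; apply: ts; rewrite inE xt orbT.
  have u1S := sS _ ts _ (mem_head _ _).
  have [UA1 _ _ d1] := AP u1 u1S.
  have lt := IH _ _ t's ut.
  (* This set misses [S]: [A u1] contains no other element of [S], and [u1] lies in no earlier set,
     hence not in W. *)
  have : dcut E U <= dcut E (A u1 :&: Wcell (cells A t')).
    apply: lowS.
      apply/subsetP => v vU; rewrite in_setI (subsetP UA1) // inE.
      rewrite cells_all // => w /(sS _ t's)/AP[/subsetP UA _ _ _].
      exact: UA.
    rewrite disjoints_subset; apply/subsetP => v vS; rewrite !inE negb_and.
    have [uv|nv] := eqVneq u1 v; last by rewrite AS.
    apply/orP; right; rewrite -uv cells_notin // => w wt.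
    apply: AS => //; first exact: sS t's _ wt.
    by apply: contraNneq u1t => <-.
  have := weight_add_cell E (cells A t') (A u1) u1.
  move: lt; rewrite /= -/(cells A t'); lia.
have us : uniq s by apply: enum_uniq.
have s2 : 1 < size s by lia.
have := light s (fun _ xs => xs) s2 us.
have : 2 * OPT E k <= weight E (cells A s).
  apply: (@OPT_le_weight _ E A s z) => //; try lia.
    move=> u; rewrite mem_enum => uS; have [_ uA _ _] := AP u uS.
    apply: cells_self => //; first by rewrite mem_enum.
    by move=> w; rewrite mem_enum; apply: AS.
  by apply: cells_all => // u; rewrite mem_enum; apply: Az.
lia.
Qed.
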